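(* Let $X$ be a nonempty set, $\Omega\subseteq\mathcal P(X)$ an algebra, $\mu$ a finite measure on $\Omega$, and let $(\overline{\Omega},\wedge,\vee)$ be as described in the context. Then $(\overline{\Omega},\wedge,\vee)$ is a complete Heyting algebra of countable type; that is, for every countable family $(x_i)_{i\in I}$ in $\overline{\Omega}$ and every $y\in\overline{\Omega}$, $\vee_{i\in I}(x_i\wedge y)=(\vee_{i\in I}x_i)\wedge y$.
   Context: A sequence $\{B_n\}\subseteq\Omega$ is $\mu$-Cauchy if $\mu(B_n\triangle B_m)\to0$ as $n,m\to\infty$. $\overline{\Omega}$ is the set of equivalence classes $\overline{\{B_n\}}$ of $\mu$-Cauchy sequences, where $\{A_n\}$ and $\{B_n\}$ are equivalent iff $\lim_n\mu(A_n\triangle B_n)=0$. Operations: $\overline{\{A_n\}}\vee\overline{\{B_n\}}=\overline{\{A_n\cup B_n\}}$, $\overline{\{A_n\}}\wedge\overline{\{B_n\}}=\overline{\{A_n\cap B_n\}}$, $\overline{\{B_n\}}^{C}=\overline{\{B_n^{C}\}}$; $E\le E'$ means $E\wedge E'=E$; $\bar\mu(\overline{\{B_n\}})=\lim_n\mu(B_n)$. For $E_1,E_2,\dots\in\overline{\Omega}$, $\vee_{i=1}^{\infty}E_i$ is the unique $E\in\overline{\Omega}$ such that $\vee_{i=1}^{n}E_i\le E$ for all $n$ and $\lim_n\bar\mu(E\wedge(\vee_{i=1}^nE_i)^{C})=0$. The paper defines: a complete lattice $L$ is a complete Heyting algebra if $\vee_{i\in I}(x_i\wedge y)=(\vee_{i\in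 I}x_i)\wedge y$ for all $x_i,y\in L$; it is of countable type when this is required for countable index sets $I$. *)

(* Defs.v *)
From HB Require Import structures.
From mathcomp Require Import all_boot all_order all_algebra generic_quotient.
From mathcomp Require Import all_classical all_reals all_analysis.
From mathcomp Require Import lra.

Set Implicit Arguments.
Unset Strict Implicit.
Unset Printing Implicit Defensive.

Import Order.TTheory Order.CTheory GRing.Theory Num.Theory.
Import numFieldNormedType.Exports.
Local Open Scope classical_set_scope.
Local Open Scope ring_scope.
Local Open Scope ereal_scope.
Local Open Scope quotient_scope.

(* The algebra Omega of subsets of X is the family of measurable sets of
   T : algebraOfSetsType (a pointed, hence nonempty, carrier); countable
   additivity of mu is required only for unions that stay in Omega.
   Finiteness of mu is needed from countable_join_theory on only. *)

Section cauchy_sequences.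
Context (R : realType) (d : measure_display) (T : algebraOfSetsType d).
Variable mu : {measure set T -> \bar R}.

Definition mu_cauchy (B : nat -> set T) : Prop :=
  mu (B p.1 `+` B p.2) @[p --> (\oo, \oo)] --> 0.

Definition mu_equiv (A B : nat -> set T) : Prop :=
  mu (A n `+` B n) @[n --> \oo] --> 0.

Record cauchy_seq : Type := CauchySeq {
  cauchy_fun :> nat -> set T;
  cauchy_funP : `[< (forall n, measurable (cauchy_fun n)) /\
                    mu_cauchy cauchy_fun >] }.

HB.instance Definition _ := [isSub for cauchy_fun].
HB.instance Definition _ := [Choice of cauchy_seq by <:].

Lemma cauchy_measurable (A : cauchy_seq) n : measurable (A n).
Proof. by case: A => A /= /asboolP[]. Qed.

Lemma cauchy_cauchy (A : cauchy_seq) : mu_cauchy A.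
Proof. by case: A => A /= /asboolP[]. Qed.

Lemma measurable_setY (A B : set T) :
  measurable A -> measurable B -> measurable (A `+` B).
Proof. by move=> mA mB; apply: measurableU; apply: measurableD. Qed.

Lemma measure_cover2 (A B C : set T) :
  measurable A -> measurable B -> measurable C ->
  A `<=` B `|` C -> mu A <= mu B + mu C.
Proof.
move=> mA mB mC AB; apply: le_trans (measureU2 mu mB mC).
by apply: le_measure; rewrite ?inE//; exact: measurableU.
Qed.

Lemma cvg0_cover2 (I : Type) (F : set_system I) {FF : Filter F}
    (f g h : I -> set T) :
  (forall i, measurable (f i)) -> (forall i, measurable (g i)) ->
  (forall i, measurable (h i)) -> (forall i, f i `<=` g i `|` h i) ->
  mu (g i) @[i --> F] --> 0 -> mu (h i) @[i --> F] --> 0 ->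
  mu (f i) @[i --> F] --> 0.
Proof.
move=> mf mg mh fgh g0 h0.
apply: (@squeeze_cvge _ _ _ _ (fun=> 0) _ (fun i => mu (g i) + mu (h i))).
- by near=> i; rewrite measure_ge0/= measure_cover2.
- exact: cvg_cst.
- by rewrite -(adde0 0); apply: cvgeD.
Unshelve. all: by end_near. Qed.

Definition cauchy_equiv (A B : cauchy_seq) : bool := `[< mu_equiv A B >].

Lemma cauchy_equiv_refl : reflexive cauchy_equiv.
Proof.
move=> A; apply/asboolP; rewrite /mu_equiv.
under eq_fun do rewrite setYK measure0.
exact: cvg_cst.
Qed.

Lemma cauchy_equiv_sym : symmetric cauchy_equiv.
Proof.
by move=> A B; congr asbool; rewrite /mu_equiv; under eq_fun do rewrite setYC.
Qed.

Lemma cauchy_equiv_trans : transitive cauchy_equiv.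
Proof.
move=> B A C /asboolP AB /asboolP BC; apply/asboolP.
apply: (cvg0_cover2 _ _ _ _ AB BC) => n;
  try by apply: measurable_setY; exact: cauchy_measurable.
move=> x [[Ax Cx]|[Cx Ax]]; case: (pselect (B n x)) => Bx.
- by right; left.
- by left; left.
- by left; right.
- by right; right.
Qed.

Canonical cauchy_equiv_rel :=
  EquivRel cauchy_equiv cauchy_equiv_refl cauchy_equiv_sym cauchy_equiv_trans.

Let cauchy_op2 (op : set T -> set T -> set T)
    (mop : forall A B, measurable A -> measurable B -> measurable (op A B))
    (sop : forall A B A' B',
       op A B `+` op A' B' `<=` (A `+` A') `|` (B `+` B')) (A B : cauchy_seq) :
  `[< (forall n, measurable (op (A n) (B n))) /\
      mu_cauchy (fun n => op (A n) (B n)) >].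
Proof.
have mA := cauchy_measurable A; have mB := cauchy_measurable B.
apply/asboolP; split => [n|]; first exact: mop.
by apply: (cvg0_cover2 _ _ _ _ (cauchy_cauchy A) (cauchy_cauchy B)) => p //=;
  apply: measurable_setY => //; exact: mop.
Qed.

Let setU_setY (A B A' B' : set T) :
  (A `|` B) `+` (A' `|` B') `<=` (A `+` A') `|` (B `+` B').
Proof.
by move=> x /=; case: (pselect (A x)) => ?; case: (pselect (A' x)) => ?;
  case: (pselect (B x)) => ?; case: (pselect (B' x)) => ?; tauto.
Qed.

Let setI_setY (A B A' B' : set T) :
  (A `&` B) `+` (A' `&` B') `<=` (A `+` A') `|` (B `+` B').
Proof.
by move=> x /=; case: (pselect (A x)) => ?; case: (pselect (A' x)) => ?;
  case: (pselect (B x)) => ?; case: (pselect (B' x)) => ?; tauto.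
Qed.

Lemma setC_setY (A B : set T) : ~` A `+` ~` B = A `+` B.
Proof.
by apply/seteqP; split=> x /=; case: (pselect (A x)) => ?;
  case: (pselect (B x)) => ?; tauto.
Qed.

Definition cauchy_union (A B : cauchy_seq) : cauchy_seq :=
  CauchySeq (cauchy_op2 (@measurableU _ T) setU_setY A B).

Definition cauchy_inter (A B : cauchy_seq) : cauchy_seq :=
  CauchySeq (cauchy_op2 (@measurableI _ T) setI_setY A B).

Let cauchy_const_subproof (S : set T) (mS : measurable S) :
  `[< (forall n : nat, measurable S) /\ mu_cauchy (fun=> S) >].
Proof.
apply/asboolP; split => //; rewrite /mu_cauchy/= -/(setY S S) setYK measure0.
exact: cvg_cst.
Qed.

Definition cauchy_const (S : set T) (mS : measurable S) : cauchy_seq :=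
  CauchySeq (cauchy_const_subproof mS).

Let cauchy_compl_subproof (A : cauchy_seq) :
  `[< (forall n, measurable (~` A n)) /\ mu_cauchy (fun n => ~` A n) >].
Proof.
apply/asboolP; split => [n|]; first exact/measurableC/cauchy_measurable.
rewrite /mu_cauchy; under eq_fun do rewrite setC_setY.
exact: cauchy_cauchy.
Qed.

Definition cauchy_compl (A : cauchy_seq) : cauchy_seq :=
  CauchySeq (cauchy_compl_subproof A).

Definition completion : Type := {eq_quot cauchy_equiv_rel}.

HB.instance Definition _ := Choice.on completion.
HB.instance Definition _ := EqQuotient.on completion.

Lemma eq_classP (A B : cauchy_seq) :
  \pi_completion A = \pi_completion B <-> mu_equiv A B.
Proof.
by split=> [/eqquotP/asboolP//|AB]; apply/eqquotP/asboolP.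
Qed.

Definition join_class : completion -> completion -> completion :=
  lift_op2 completion cauchy_union.
Definition meet_class : completion -> completion -> completion :=
  lift_op2 completion cauchy_inter.
Definition compl_class : completion -> completion :=
  lift_op1 completion cauchy_compl.

Let equiv_repr (A : cauchy_seq) : mu_equiv A (repr (\pi_completion A)).
Proof. by apply/eq_classP; rewrite reprK. Qed.

Lemma join_classE (A B : cauchy_seq) :
  join_class (\pi A) (\pi B) = \pi_completion (cauchy_union A B).
Proof.
unlock join_class; apply/esym/eq_classP.
by apply: (cvg0_cover2 _ _ _ _ (equiv_repr A) (equiv_repr B)) => n;
  rewrite //; try (apply: measurable_setY; exact: cauchy_measurable);
  exact: setU_setY.
Qed.

Lemma meet_classE (A B : cauchy_seq) :
  meet_class (\pi A) (\pi B) = \pi_completion (cauchy_inter A B).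
Proof.
unlock meet_class; apply/esym/eq_classP.
by apply: (cvg0_cover2 _ _ _ _ (equiv_repr A) (equiv_repr B)) => n;
  rewrite //; try (apply: measurable_setY; exact: cauchy_measurable);
  exact: setI_setY.
Qed.

Lemma compl_classE (A : cauchy_seq) :
  compl_class (\pi A) = \pi_completion (cauchy_compl A).
Proof.
unlock compl_class; apply/esym/eq_classP; rewrite /mu_equiv.
under eq_fun do rewrite setC_setY.
exact: equiv_repr.
Qed.

End cauchy_sequences.

Section completion_lattice.
Context (R : realType) (d : measure_display) (T : algebraOfSetsType d).
Variable mu : {measure set T -> \bar R}.
Local Notation Omega := (completion mu).
Local Notation cl := (\pi_(completion mu)).

Definition bottom_class : Omega := cl (cauchy_const mu measurable0).
Definition top_class : Omega := cl (cauchy_const mu measurableT).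

Let cl_eq (A B : cauchy_seq mu) : A =1 B -> cl A = cl B.
Proof. by move=> AB; congr (cl _); apply/val_inj/funext. Qed.

Let classE := (join_classE, meet_classE, compl_classE).

Fact meet_classC : commutative (@meet_class _ _ _ mu).
Proof.
elim/quotW => A; elim/quotW => B; rewrite !classE.
by apply: cl_eq => n; exact: setIC.
Qed.

Fact join_classC : commutative (@join_class _ _ _ mu).
Proof.
elim/quotW => A; elim/quotW => B; rewrite !classE.
by apply: cl_eq => n; exact: setUC.
Qed.

Fact meet_classA : associative (@meet_class _ _ _ mu).
Proof.
elim/quotW => A; elim/quotW => B; elim/quotW => C; rewrite !classE.
by apply: cl_eq => n; exact: setIA.
Qed.

Fact join_classA : associative (@join_class _ _ _ mu).
Proof.
elim/quotW => A; elim/quotW => B; elim/quotW => C; rewrite !classE.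
by apply: cl_eq => n; exact: setUA.
Qed.

Fact join_classKI (F E : Omega) : meet_class E (join_class E F) = E.
Proof.
elim/quotW: E => A; elim/quotW: F => B; rewrite !classE.
by apply: cl_eq => n /=; rewrite setUC setKU.
Qed.

Fact meet_classKU (F E : Omega) : join_class E (meet_class E F) = E.
Proof.
elim/quotW: E => A; elim/quotW: F => B; rewrite !classE.
by apply: cl_eq => n /=; rewrite setIC setKI.
Qed.

Fact meet_classUl : left_distributive (@meet_class _ _ _ mu) (@join_class _ _ _ mu).
Proof.
elim/quotW => A; elim/quotW => B; elim/quotW => C; rewrite !classE.
by apply: cl_eq => n; exact: setIUl.
Qed.

Fact meet_classxx : idempotent_op (@meet_class _ _ _ mu).
Proof.
by elim/quotW => A; rewrite !classE; apply: cl_eq => n; exact: setIid.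
Qed.

Fact completion_display : Order.disp_t. Proof. exact: Order.default_display. Qed.

HB.instance Definition _ :=
  @Order.isMeetJoinDistrLattice.Build completion_display Omega
    (fun E F => meet_class E F == E)
    (fun E F => (F != E) && (meet_class E F == E))
    (@meet_class _ _ _ mu) (@join_class _ _ _ mu)
    (fun _ _ => erefl) (fun _ _ => erefl)
    meet_classC join_classC meet_classA join_classA
    join_classKI meet_classKU meet_classUl meet_classxx.

Fact bottom_class_le (E : Omega) : (bottom_class <= E)%O.
Proof.
elim/quotW: E => A; apply/eqP; rewrite -[LHS]/(meet_class _ _) classE.
by apply: cl_eq => n; exact: set0I.
Qed.

Fact le_top_class (E : Omega) : (E <= top_class)%O.
Proof.
elim/quotW: E => A; apply/eqP; rewrite -[LHS]/(meet_class _ _) classE.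
by apply: cl_eq => n; exact: setIT.
Qed.

HB.instance Definition _ :=
  @Order.hasBottom.Build completion_display Omega bottom_class bottom_class_le.
HB.instance Definition _ :=
  @Order.hasTop.Build completion_display Omega top_class le_top_class.

Fact join_classC_top (E : Omega) : (E `|` compl_class E)%O = \top%O.
Proof.
elim/quotW: E => A; rewrite -[LHS]/(join_class _ _) !classE.
by apply: cl_eq => n; exact: setUv.
Qed.

Fact meet_classC_bottom (E : Omega) : (E `&` compl_class E)%O = \bot%O.
Proof.
elim/quotW: E => A; rewrite -[LHS]/(meet_class _ _) !classE.
by apply: cl_eq => n; exact: setICr.
Qed.

HB.instance Definition _ :=
  @Order.TBDistrLattice_hasComplement.Build completion_display Omega
    (@compl_class _ _ _ mu) join_classC_top meet_classC_bottom.

Lemma join_piE (A B : cauchy_seq mu) :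
  (cl A `|` cl B)%O = cl (cauchy_union A B).
Proof. exact: join_classE. Qed.

Lemma meet_piE (A B : cauchy_seq mu) :
  (cl A `&` cl B)%O = cl (cauchy_inter A B).
Proof. exact: meet_classE. Qed.

Lemma compl_piE (A : cauchy_seq mu) : (~` cl A)%O = cl (cauchy_compl A).
Proof. exact: compl_classE. Qed.

Definition mubar : Omega -> \bar R :=
  lift_fun1 Omega (fun A : cauchy_seq mu => lim (mu (A n) @[n --> \oo])).

(* The sequence is indexed from 0, so the finite joins are
   E 0 `|` ... `|` E n. *)
Definition is_countable_join (E : nat -> Omega) (J : Omega) : Prop :=
  (forall n, \join_(i < n.+1) E i <= J)%O /\
  mubar (J `&` ~` \join_(i < n.+1) E i)%O @[n --> \oo] --> 0.

(* When mu is finite the default \bot is never used: see countable_joinP and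
   countable_join_uniq. *)
Definition countable_join (E : nat -> Omega) : Omega :=
  xget \bot%O (is_countable_join E).

(* The join of a countable family is the countable join along the enumeration
   of the index type, padded with \bot where unpickle is undefined; it does
   not depend on the enumeration (family_join_supremums). *)
Definition family_join (I : countType) (x : I -> Omega) : Omega :=
  countable_join (fun n => oapp x \bot%O (unpickle n)).

End completion_lattice.

Section countable_join_theory.
Context (R : realType) (d : measure_display) (T : algebraOfSetsType d).
Variable mu : {measure set T -> \bar R}.
Local Notation Omega := (completion mu).
Local Notation cl := (\pi_(completion mu)).
Hypothesis mu_fin : mu [set: T] < +oo.

Let mufin (A : set T) : measurable A -> mu A \is a fin_num.
Proof. exact: lty_fin_num_fun. Qed.

Lemma cvg0_fineP (I : Type) (F : set_system I) {FF : Filter F}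
    (f : I -> set T) : (forall i, measurable (f i)) ->
  mu (f i) @[i --> F] --> 0 <->
  forall e : R, (0 < e)%R -> \forall i \near F, (fine (mu (f i)) < e)%R.
Proof.
move=> mf; have f0 i : (0 <= fine (mu (f i)))%R by rewrite fine_ge0.
split=> [/fine_cvgP[_ /cvgr0Pnorm_lt h] e e0|h].
  have {h} := h e e0.
  by apply: filterS => i /=; rewrite ger0_norm.
apply/fine_cvgP; split; first by near=> i; rewrite mufin.
apply/cvgr0Pnorm_lt => e e0; have {h} := h e e0.
by apply: filterS => i /=; rewrite ger0_norm.
Unshelve. all: by end_near. Qed.

Let mY (A B : cauchy_seq mu) n m : measurable (A n `+` B m).
Proof. by apply: measurable_setY; exact: cauchy_measurable. Qed.

Let fine_cover2 (A B C : set T) : measurable A -> measurable B ->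
  measurable C -> A `<=` B `|` C ->
  (fine (mu A) <= fine (mu B) + fine (mu C))%R.
Proof.
move=> mA mB mC ABC; rewrite -fineD ?mufin//.
by rewrite fine_le ?fin_numD ?mufin//; exact: measure_cover2.
Qed.

Let fine_dist (A B : set T) : measurable A -> measurable B ->
  (`|fine (mu A) - fine (mu B)| <= fine (mu (A `+` B)))%R.
Proof.
have h (S S' : set T) : measurable S -> measurable S' ->
    (fine (mu S) <= fine (mu S') + fine (mu (S `+` S')))%R.
  move=> mS mS'; apply: fine_cover2 => //; first exact: measurable_setY.
  move=> x Ax; have [|] := pselect (S' x); first by left.
  by right; left.
move=> mA mB; have := h _ _ mA mB; have := h _ _ mB mA.
rewrite [B `+` A]setYC => h1 h2.
by rewrite ler_norml; apply/andP; split; lra.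
Qed.

Lemma mu_fine_is_cvg (A : cauchy_seq mu) : cvgn (fun n => fine (mu (A n))).
Proof.
have mA := cauchy_measurable A.
apply/cauchy_cvgP/cauchy_ballP => e e0.
have /cvg0_fineP h := cauchy_cauchy A.
have {h} := h (fun=> mY _ _ _ _) e e0.
case=> -[P Q] /= [P0 Q0] PQ.
exists ([set fine (mu (A n)) | n in P], [set fine (mu (A n)) | n in Q]).
  split => /=; last by apply: filterS Q0 => n Qn; exists n.
  by apply: filterS P0 => n Pn; exists n.
move=> [_ _] /= [[n Pn <-] [m Qm <-]].
rewrite -ball_normE/=; apply: le_lt_trans (fine_dist (mA n) (mA m)) _.
exact: PQ (n, m) _.
Qed.

Lemma mubarE (A : cauchy_seq mu) :
  mubar (cl A) = (lim (fine (mu (A n)) @[n --> \oo]))%:E.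
Proof.
have h (B : cauchy_seq mu) : mu (B n) @[n --> \oo] -->
    (lim (fine (mu (B n)) @[n --> \oo]))%:E.
  apply/fine_cvgP; split; last exact: mu_fine_is_cvg.
  by near=> n; exact/mufin/cauchy_measurable.
unlock mubar; rewrite (cvg_lim _ (h (repr (cl A))))//; congr EFin.
have : mu_equiv mu A (repr (cl A)) by apply/eq_classP; rewrite reprK.
move=> /cvg0_fineP -/(_ (fun=> mY _ _ _ _)) AB.
apply/eqP; rewrite eq_sym -subr_eq0 -limB; try exact: mu_fine_is_cvg.
apply/eqP/cvg_lim => //; apply/cvgr0Pnorm_lt => e e0.
have {AB} := AB e e0; apply: filterS => n; apply: le_lt_trans.
by apply: fine_dist; exact: cauchy_measurable.
Unshelve. all: by end_near. Qed.

Definition nu (E : Omega) : R := fine (mubar E).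

Lemma nu_cvg (A : cauchy_seq mu) : fine (mu (A n)) @[n --> \oo] --> nu (cl A).
Proof. by rewrite /nu mubarE; exact: mu_fine_is_cvg. Qed.

Lemma mubar_nu (E : Omega) : mubar E = (nu E)%:E.
Proof. by elim/quotW: E => A; rewrite /nu mubarE. Qed.

Arguments nu_cvg A : clear implicits.

Lemma nu_ge0 (E : Omega) : (0 <= nu E)%R.
Proof.
elim/quotW: E => A; apply: (cvgr_to_ge (nu_cvg A)).
by apply: nearW => n; rewrite fine_ge0.
Qed.

Lemma nuU (E F : Omega) : (nu (E `|` F)%O <= nu E + nu F)%R.
Proof.
elim/quotW: E => A; elim/quotW: F => B; rewrite join_piE.
apply: (ler_cvg_to (nu_cvg _) (cvgD (nu_cvg A) (nu_cvg B))).
apply: nearW => n; apply: fine_cover2 => //=;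
  by [exact: cauchy_measurable|apply: measurableU; exact: cauchy_measurable].
Qed.

Lemma nuID (E F : Omega) : nu E = (nu (E `&` F)%O + nu (E `&` ~` F)%O)%R.
Proof.
elim/quotW: E => A; elim/quotW: F => B; rewrite compl_piE !meet_piE.
have AB := cvgD (nu_cvg (cauchy_inter A B))
  (nu_cvg (cauchy_inter A (cauchy_compl B))).
rewrite -(cvg_lim _ (nu_cvg A))//; apply: cvg_lim => //.
suff -> : (fun n => fine (mu (A n))) = ((fun n => fine (mu (cauchy_inter A B n))) +
  (fun n => fine (mu (cauchy_inter A (cauchy_compl B) n))))%R by exact: AB.
apply/funext => n.
have mA := cauchy_measurable A n; have mB := cauchy_measurable B n.
have mI := measurableI _ _ mA mB.
have mD : measurable (A n `&` ~` B n) by rewrite -setDE; exact: measurableD.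
by rewrite fctE -fineD ?mufin// (measureDI mu mA mB) setDE addeC.
Qed.

Lemma nu0 : nu \bot%O = 0%R.
Proof.
have := nu_cvg (cauchy_const mu measurable0) => /=.
under eq_fun do rewrite measure0 /=.
by move/cvg_lim => <-//; apply: cvg_lim => //; exact: cvg_cst.
Qed.

Lemma nu_eq0 (E : Omega) : nu E = 0%R -> E = \bot%O.
Proof.
elim/quotW: E => A A0; apply/eq_classP; rewrite /mu_equiv.
under eq_fun do rewrite setY0.
apply/fine_cvgP; split; last by have := nu_cvg A; rewrite A0.
by near=> n; exact/mufin/cauchy_measurable.
Unshelve. all: by end_near. Qed.

Lemma nu_le (E F : Omega) : (E <= F)%O -> (nu E <= nu F)%R.
Proof.
by move=> EF; rewrite (nuID F E) (meet_r EF) lerDl nu_ge0.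
Qed.

Lemma nu_diff_eq0 (E F : Omega) : nu (E `&` ~` F)%O = 0%R -> (E <= F)%O.
Proof. by move/nu_eq0/eqP; rewrite -diffE diff_eq0. Qed.

Lemma nu_diff_triangle (F E G : Omega) :
  (nu (E `&` ~` G)%O <= nu (E `&` ~` F)%O + nu (F `&` ~` G)%O)%R.
Proof.
apply: le_trans (nuU _ _); apply: nu_le.
rewrite -[leLHS]meetx1 -(joinxC F) meetUr [leLHS]joinC.
apply: leU2; first by apply: leI2 => //; exact: leIl.
by rewrite meetC; apply: leI2 => //; exact: leIr.
Qed.

Lemma nu_diff_le (A B : cauchy_seq mu) (e : R) :
  (\forall n \near \oo, (fine (mu (A n `+` B n)) <= e)%R) ->
  (nu (cl A `&` ~` cl B)%O <= e)%R.
Proof.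
move=> ABe; rewrite compl_piE meet_piE; apply: (cvgr_to_le (nu_cvg _)).
apply: filterS ABe => n; apply: le_trans.
have mA := cauchy_measurable A n; have mB := cauchy_measurable B n.
rewrite fine_le ?mufin//=; first by apply: measurableI => //; exact: measurableC.
apply: le_measure; rewrite ?inE//.
  by apply: measurableI => //; exact: measurableC.
by move=> x; left.
Qed.

Lemma nu_const (S : set T) (mS : measurable S) :
  nu (cl (cauchy_const mu mS)) = fine (mu S).
Proof.
have := nu_cvg (cauchy_const mu mS) => /= /cvg_lim <-//.
by apply: cvg_lim => //; exact: cvg_cst.
Qed.

Definition completion_dist (E F : Omega) : R :=
  (nu (E `&` ~` F)%O + nu (F `&` ~` E)%O)%R.

Lemma distC E F : completion_dist E F = completion_dist F E.
Proof. exact: addrC. Qed.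

Lemma dist_triangle (F E G : Omega) : (completion_dist E G <= completion_dist E F + completion_dist F G)%R.
Proof.
have := nu_diff_triangle F E G; have := nu_diff_triangle F G E.
by rewrite /completion_dist; lra.
Qed.

Lemma dist_const (S S' : set T) (mS : measurable S) (mS' : measurable S') :
  fine (mu (S `+` S')) =
  completion_dist (cl (cauchy_const mu mS)) (cl (cauchy_const mu mS')).
Proof.
have mD (A B : set T) : measurable A -> measurable B -> measurable (A `&` ~` B).
  by move=> mA mB; rewrite -setDE; exact: measurableD.
have E (A B : set T) (mA : measurable A) (mB : measurable B) :
    nu (cl (cauchy_const mu mA) `&` ~` cl (cauchy_const mu mB))%O =
    fine (mu (A `\` B)).
  rewrite setDE -(nu_const (mD _ _ mA mB)) compl_piE meet_piE.
  by congr (nu (cl _)); exact/val_inj.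
rewrite /completion_dist !E -fineD ?mufin//; try exact: measurableD.
rewrite /setY measureU//; try exact: measurableD.
by apply/seteqP; split => x //= [] [? ?] [].
Qed.

Lemma dist_le (A B : cauchy_seq mu) (e : R) :
  (\forall n \near \oo, (fine (mu (A n `+` B n)) <= e)%R) ->
  (completion_dist (cl A) (cl B) <= e + e)%R.
Proof.
move=> ABe; rewrite lerD// nu_diff_le//.
by under eq_near do rewrite setYC.
Qed.

Lemma cauchyP_eps (A : nat -> set T) : (forall n, measurable (A n)) ->
  mu_cauchy mu A <-> forall e : R, (0 < e)%R ->
    exists N, forall n m, (N <= n)%N -> (N <= m)%N ->
      (fine (mu (A n `+` A m)) < e)%R.
Proof.
move=> mA; have mY' p : measurable (A p.1 `+` A p.2).
  exact: measurable_setY.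
split=> [/(cvg0_fineP mY') h e /h|h].
  case=> -[P Q] /= [[N _ NP] [M _ MQ]] PQ; exists (maxn N M) => n m.
  rewrite !geq_max => /andP[Nn _] /andP[_ Mm].
  by apply: (PQ (n, m)); split; [exact: NP|exact: MQ].
apply/(cvg0_fineP mY') => e /h[N Ne].
exists ([set n | (N <= n)%N], [set n | (N <= n)%N]).
  by split; exact: nbhs_infty_ge.
by move=> [n m] /= [? ?]; exact: Ne.
Qed.

Lemma dist_tail (A : cauchy_seq mu) (e : R) : (0 < e)%R ->
  exists N, forall n, (N <= n)%N ->
  (completion_dist (cl A) (cl (cauchy_const mu (cauchy_measurable A n))) <= e)%R.
Proof.
move=> e0; have e20 : (0 < e / 2)%R by rewrite divr_gt0.
have [N NA] := (cauchyP_eps (cauchy_measurable A)).1 (cauchy_cauchy A) _ e20.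
exists N => n Nn; rewrite [leRHS]splitr; apply: dist_le.
by exists N => // m /= Nm; apply: ltW; apply: NA.
Qed.

Lemma completion_dense (E : Omega) (e : R) : (0 < e)%R ->
  exists S : {S : set T | measurable S},
    (completion_dist E (cl (cauchy_const mu (proj2_sig S))) <= e)%R.
Proof.
elim/quotW: E => A /dist_tail -/(_ A)[N] /(_ _ (leqnn N)) h.
by exists (exist _ _ (cauchy_measurable A N)).
Qed.

Let quarters (r a b c u v p q : R) : (0 < r -> a <= b + c -> c <= u + v ->
  b <= p -> u <= r / 4 -> v <= q -> p <= r / 4 -> q <= r / 4 -> a < r)%R.
Proof. by lra. Qed.

Section existence.
Variable x : nat -> Omega.
Let C n : Omega := (\join_(i < n.+1) x i)%O.

Lemma partial_join_le n m : (n <= m)%N -> (C n <= C m)%O.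
Proof.
move=> nm; apply/joinsP => i _.
by exact: (@joins_sup _ _ _ (widen_ord (nm : n < m.+1)%N i) xpredT (fun i : 'I_m.+1 => x i)).
Qed.

Let C_dist (e : R) : (0 < e)%R -> exists N, forall n m, (N <= n)%N ->
  (N <= m)%N -> (completion_dist (C n) (C m) <= e)%R.
Proof.
have h n m : (n <= m)%N -> completion_dist (C n) (C m) = (nu (C m) - nu (C n))%R.
  move=> nm; have nmC := partial_join_le nm.
  rewrite (nuID (C m) (C n)) (meet_r nmC) addrC addKr /completion_dist.
  suff -> : (C n `&` ~` C m)%O = \bot%O by rewrite nu0 add0r.
  by apply/eqP; rewrite -diffE diff_eq0.
have nC : nondecreasing_seq (fun n => nu (C n)).
  by move=> n m nm; apply/nu_le/partial_join_le.
have : cvgn (fun n => nu (C n)).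
  apply: nondecreasing_is_cvgn => //; exists (nu \top%O) => _ [n _ <-].
  exact/nu_le/lex1.
move=> /cvgrPdist_le h' e0; have {h'} := h' (e / 2)%R.
rewrite divr_gt0// => /(_ isT)[N _ Ne]; exists N => n m Nn Nm.
have := Ne n Nn; have := Ne m Nm => /=; rewrite !ler_norml.
by have [/h ->|/ltnW/h] := leqP n m; [|rewrite distC => ->];
  move=> /andP[? ?] /andP[? ?]; lra.
Qed.

Lemma countable_join_ex : exists J, is_countable_join x J.
Proof.
pose e n : R := n.+1%:R^-1%R.
have e0 n : (0 < e n)%R by rewrite invr_gt0.
have e_small (r : R) : (0 < r)%R ->
    exists N, forall n, (N <= n)%N -> (e n <= r)%R.
  have /cvgrPdist_le h := @cvg_harmonic R.
  move=> /h[N _ Nr]; exists N => n /Nr/=.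
  by rewrite sub0r normrN ger0_norm// ltW.
have [S CS] := choice (fun n => completion_dense (C n) (e0 n)).
pose B n := sval (S n).
pose mB n : measurable (B n) := proj2_sig (S n).
have {}CS n : (completion_dist (C n) (cl (cauchy_const mu (mB n))) <= e n)%R := CS n.
clearbody mB.
have Bcauchy : mu_cauchy mu B.
  apply/cauchyP_eps => // r r0.
  have r40 : (0 < r / 4)%R by rewrite divr_gt0.
  have [N NC] := C_dist r40; have [M Me] := e_small _ r40.
  exists (maxn N M) => n m; rewrite !geq_max => /andP[Nn Mn] /andP[Nm Mm].
  rewrite (dist_const (mB n) (mB m)).
  have t1 := dist_triangle (C n) (cl (cauchy_const mu (mB n)))
    (cl (cauchy_const mu (mB m))).
  have t2 := dist_triangle (C m) (C n) (cl (cauchy_const mu (mB m))).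
  rewrite [completion_dist _ (C n)]distC in t1.
  exact: quarters r0 t1 t2 (CS n) (NC n m Nn Nm) (CS m) (Me n Mn) (Me m Mm).
pose Bseq := CauchySeq (introT (asboolP _) (conj mB Bcauchy)).
pose J := cl Bseq.
have JC (r : R) : (0 < r)%R ->
    exists N, forall n, (N <= n)%N -> (completion_dist J (C n) <= r)%R.
  move=> r0; have r20 : (0 < r / 2)%R by rewrite divr_gt0.
  have [N NB] := dist_tail Bseq r20; have [M Me] := e_small _ r20.
  exists (maxn N M) => n; rewrite geq_max => /andP[Nn Mn].
  apply: le_trans (dist_triangle (cl (cauchy_const mu (mB n))) _ _) _.
  rewrite [leRHS]splitr lerD//.
    by have := NB n Nn; rewrite (Prop_irrelevance (cauchy_measurable Bseq n) (mB n)).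
  by rewrite distC (le_trans (CS n))// Me.
exists J; split => [n|].
  apply: nu_diff_eq0; apply/eqP; rewrite eq_le nu_ge0 andbT.
  apply/ler_addgt0Pl => r r0; rewrite addr0.
  have [N /(_ _ (leq_maxl N n))] := JC _ r0.
  apply: le_trans; apply: (@le_trans _ _ (nu (C (maxn N n) `&` ~` J)%O)).
    by apply: nu_le; rewrite leI2// partial_join_le// leq_maxr.
  by rewrite lerDr nu_ge0.
under eq_fun do rewrite mubar_nu.
apply/fine_cvgP; split; first exact: nearW.
apply/cvgr0Pnorm_le => r /JC[N NJ]; exists N => // n /= /NJ.
by rewrite ger0_norm ?nu_ge0//; apply: le_trans; rewrite lerDl nu_ge0.
Qed.

Lemma countable_join_supremums J :
  is_countable_join x J -> supremums (range x) J.
Proof.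
move=> [CJ JC]; split=> [_ [n _ <-]|F Fx].
  apply: le_trans (CJ n).
  exact: (@joins_sup _ _ _ (ord_max : 'I_n.+1) xpredT (fun i => x i)).
apply: nu_diff_eq0; apply/eqP; rewrite eq_le nu_ge0 andbT -lee_fin -mubar_nu.
apply: (cvge_to_ge JC); apply: nearW => n.
rewrite !mubar_nu lee_fin nu_le// leI2// leC.
by apply/joinsP => i _; apply: Fx; exists i.
Qed.

End existence.

Lemma countable_joinP (x : nat -> Omega) :
  is_countable_join x (countable_join x).
Proof.
rewrite /countable_join; case: xgetP => // h.
by have [J /h] := countable_join_ex x.
Qed.

Lemma countable_join_uniq (x : nat -> Omega) (J : Omega) :
  is_countable_join x J -> countable_join x = J.
Proof.
move=> xJ; apply: is_subset1_supremums;
  apply: countable_join_supremums; [exact: countable_joinP|exact: xJ].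
Qed.

Lemma family_join_supremums (I : countType) (x : I -> Omega) :
  supremums (range x) (family_join x).
Proof.
have [ub lub] := countable_join_supremums
  (countable_joinP (fun n => oapp x \bot%O (unpickle n))).
split=> [_ [i _ <-]|F Fx].
  by apply: ub; exists (pickle i) => //; rewrite pickleK.
apply: lub => _ [n _ <-]; case: (unpickle n) => [i|]; last exact: le0x.
by apply: Fx; exists i.
Qed.

Lemma family_join_nat (x : nat -> Omega) : family_join x = countable_join x.
Proof. by []. Qed.

End countable_join_theory.

Section heyting.
Local Open Scope order_scope.

Definition complete_lattice disp (L : latticeType disp) : Prop :=
  forall S : set L, supremums S !=set0 /\ infimums S !=set0.

(* The default \bot of supremum is its value on the empty family. *)
Definition complete_heyting_of_countable_type disp (L : bLatticeType disp) :
    Prop :=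
  complete_lattice L /\
  forall (I : countType) (x : I -> L) (y : L),
    supremum \bot [set x i `&` y | i in [set: I]] =
    supremum \bot [set x i | i in [set: I]] `&` y.

End heyting.

(* Main.v *)
(** Completeness: let [W] be the set of lower bounds of the upper bounds of a
    set [S]. It contains [S] and is closed under countable joins, hence some
    [J] in [W] maximises the measure on [W]. For [E] in [S], the join of [J] and
    [E] is again in [W], so it has the same measure as [J]; hence [E] minus [J]
    is null, that is, [E <= J], and [J] is the supremum of [S].
    Distributivity holds in any complemented distributive lattice, because
    [- `&` y] is left adjoint to [- `|` ~` y] and so preserves suprema. *)
Require Import Defs.
From mathcomp Require Import all_boot all_order all_algebra.
From mathcomp Require Import all_classical all_reals all_analysis.
Local Open Scope classical_set_scope.
Local Open Scope ring_scope.
Local Open Scope order_scope.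

Set Implicit Arguments.
Unset Strict Implicit.
Unset Printing Implicit Defensive.

Import Order.TTheory Order.CTheory GRing.Theory Num.Theory.
Import numFieldNormedType.Exports.

Section supremums.
Context (disp : Order.disp_t).

Lemma supremum_eq (L : porderType disp) (x0 s : L) (A : set L) :
  A !=set0 -> supremums A s -> supremum x0 A = s.
Proof.
move=> /set0P/negbTE A0 As; rewrite /supremum A0.
by apply: is_subset1_supremums (As); case: xgetP => // /(_ _ As).
Qed.

(** Each element of [A] is an upper bound of [lbound A], so [s] lies below it. This reduces infima
    to suprema. *)
Lemma infimums_lbound (L : porderType disp) (A : set L) (s : L) :
  supremums (lbound A) s -> infimums A s.
Proof.
by move=> [ub lub]; split => // x Ax; apply: lub => y; apply.
Qed.

Lemma leIC_U (L : ctbDistrLatticeType disp) (x y z : L) :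
  (x `&` y <= z) = (x <= ~` y `|` z).
Proof. by rewrite -leBLR diffE complK. Qed.

Lemma supremums_meetr (L : ctbDistrLatticeType disp) (I : Type) (x : I -> L)
    (y s : L) :
  supremums (range x) s -> supremums (range (fun i => x i `&` y)) (s `&` y).
Proof.
move=> [ub lub]; split=> [_ [i _ <-]|z zub].
  by apply: leI2 => //; apply: ub; exists i.
rewrite leIC_U; apply: lub => _ [i _ <-].
by rewrite -leIC_U; apply: zub; exists i.
Qed.

End supremums.

Section completeness.
Context (R : realType) (d : measure_display) (T : algebraOfSetsType d).
Variable mu : {measure set T -> \bar R}.
Hypothesis mu_fin : (mu [set: T] < +oo)%E.
Local Notation Omega := (completion mu).

(** The join of a sequence in [W] whose measures approach the supremum of [nu] on [W] stays in [W]
    and, by monotonicity of [nu], attains that supremum. *)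
Lemma nu_max (W : set Omega) : W !=set0 ->
  (forall (x : nat -> Omega) J,
    (forall n, W (x n)) -> supremums (range x) J -> W J) ->
  exists2 J, W J & forall E, W E -> (nu E <= nu J)%R.
Proof.
move=> [E0 WE0] Wsup; pose V := [set nu E | E in W].
have V_sup : has_sup V.
  split; first by exists (nu E0); exists E0.
  by exists (nu (\top : Omega)) => _ [E _ <-]; exact/(nu_le mu_fin)/lex1.
have approx (n : nat) : exists E, W E /\ (sup V - n.+1%:R^-1 < nu E)%R.
  have n0 : (0 < n.+1%:R^-1 :> R)%R by rewrite invr_gt0.
  by have [_ [E WE <-] ?] := sup_adherent n0 V_sup; exists E.
have [x xP] := choice approx.
have Jsup := countable_join_supremums mu_fin (countable_joinP mu_fin x).
exists (countable_join x); first by apply: Wsup Jsup => n; exact: (xP n).1.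
move=> E WE; apply: (@le_trans _ _ (sup V)).
  by apply: sup_upper_bound => //; exists E.
apply/ler_addgt0Pl => e e0.
(* Choose [N] with [1/(N+1) < e], so that [nu (x N) > sup V - e]. *)
have /cvgrPdist_lt/(_ e e0)[N _ /(_ N (leqnn N))] := @cvg_harmonic R.
rewrite /= sub0r normrN ger0_norm ?invr_ge0// => Ne.
have xJ : (nu (x N) <= nu (countable_join x))%R.
  by apply: (nu_le mu_fin); apply: Jsup.1; exists N.
rewrite -lerBlDl; apply: le_trans xJ; apply: ltW.
by apply: le_lt_trans (xP N).2; rewrite lerB// ltW.
Qed.

Lemma completion_supremums (S : set Omega) : supremums S !=set0.
Proof.
pose W := lbound (ubound S).
have [||J WJ Jmax] := @nu_max W.
(* [\bot] lies in [W] even when [S] is empty. *)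
- by exists \bot => F _; exact: le0x.
- by move=> x J Wx [_ Jlub] F FS; apply: Jlub => _ [n _ <-]; exact: Wx.
(* [WJ] already says that [J] lies below every upper bound of [S]; it remains to bound each [E] in
   [S] by [J]. *)
exists J; split => // E SE; apply: (nu_diff_eq0 mu_fin).
have WJE : W (J `|` E) by move=> F FS; rewrite leUx WJ// FS.
have := Jmax _ WJE.
(* Splitting the join along [J] turns maximality into [nu J] plus the measure of [E] minus [J] being
   at most [nu J]. *)
rewrite (nuID mu_fin (J `|` E) J) (meet_r (leUl _ _)) meetUl meetxC join0x gerDl => le0.
by apply/eqP; rewrite eq_le le0 nu_ge0.
Qed.

End completeness.

Theorem theorem5 (R : realType) (d : measure_display)
    (T : algebraOfSetsType d) (mu : {measure set T -> \bar R})
    (mu_fin : (mu [set: T] < +oo)%E) :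
  complete_heyting_of_countable_type (completion mu) /\
  forall (I : countType) (x : I -> completion mu) (y : completion mu),
    family_join (fun i : I => x i `&` y) = family_join x `&` y.
Proof.
have join_sup (I : countType) (x : I -> completion mu) :=
  family_join_supremums mu_fin x.
split; last first.
  (* Both sides are suprema of the same family, hence equal. *)
  move=> I x y; apply: is_subset1_supremums (join_sup _ _) _.
  exact: supremums_meetr (join_sup _ _).
split=> [S|I x y].
  split; first exact: completion_supremums.
  have [s Ss] := completion_supremums mu_fin (lbound S).
  by exists s; exact: infimums_lbound.
have [[i _]|/set0P/negP/negPn/eqP I0] := pselect ([set: I] !=set0).
  rewrite (supremum_eq _ _ (join_sup _ x)); last by exists (x i); exists i.
  apply: supremum_eq; first by exists (x i `&` y); exists i.
  exact: supremums_meetr (join_sup _ _).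
(* For empty [I] both suprema take the default value [\bot]. *)
by rewrite I0 !image_set0 supremum0 meet0x.
Qed.
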